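(* Let $X,Y,Z,W$ be locally convex Hausdorff topological vector spaces, $K\subset Y$ a proper closed convex cone with $\operatorname{int}K\ne\emptyset$, $P\subset W$ and $S\subset Z$ nonempty convex cones, $F\colon X\to Y^\infty$, $\kappa\colon W\to Y^\infty$, $H\colon X\to W^\infty$, $G\colon X\to Z^\infty$ proper mappings, $C\subset X$ nonempty, $A=C\cap G^{-1}(-S)$, and assume $A\cap\operatorname{dom}F\cap H^{-1}(\operatorname{dom}\kappa)\neq\emptyset$. Put $$\mathcal M^2=\bigcup_{T_1\in\operatorname{dom}\kappa^*,\; T_2\in\mathcal L_+^w(S,K)}\Psi\big(\mathfrak E\mathrm{pi}F^*\boxplus\mathfrak E\mathrm{pi}(T_1\circ H+T_2\circ G+I_C)^*\boxplus\{(0_{\mathcal L},\kappa^*(T_1)\uplus I_{-S}^*(T_2))\}\big),$$ $$\mathcal M^2_+=\bigcup_{T_1\in\operatorname{dom}\kappa^*\cap\mathcal L_+(P,K),\; T_2\in\mathcal L_+(S,K)}\Psi\big(\mathfrak E\mathrm{pi}F^*\boxplus\mathfrak E\mathrm{pi}(T_1\circ H+T_2\circ G+I_C)^*\boxplus\{(0_{\mathcal L},\kappa^*(T_1))\}\big).$$ Consider the statements: $(\mathrm a_2)$ $\operatorname{epi}(F+\kappa\circ H+I_A)^*=\mathcal M^2$; $(\mathrm b_2)$ $\operatorname{epi}(F+\kappa\circ H+I_A)^*=\mathcal M^2_+$; $(\mathrm e_2)$ stable strong duality holds for $(\mathrm{CCVP})-(\mathrm{CCVD}^2)$: for every $L\in\mathcal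 L(X,Y)$, $\operatorname{WInf}\{F(x)+(\kappa\circ H)(x)-L(x):x\in A\}=\operatorname{WMax}D_L$, where $D_L$ is the union over $L'\in\mathcal L(X,Y)$, $T_1\in\operatorname{dom}\kappa^*$, $T_2\in\mathcal L_+^w(S,K)$ of the sets $$-\big[F^*(L')\uplus(T_1\circ H+T_2\circ G+I_C)^*(L-L')\uplus\kappa^*(T_1)\uplus I_{-S}^*(T_2)\big];$$ $(\mathrm f_2)$ stable strong duality holds for $(\mathrm{CCVP})-(\mathrm{CCVD}^2_\ell)$: for every $L\in\mathcal L(X,Y)$, $\operatorname{WInf}\{F(x)+(\kappa\circ H)(x)-L(x):x\in A\}=\operatorname{WMax}D_L^+$, where $D_L^+$ is the union over $L'\in\mathcal L(X,Y)$, $T_1\in\operatorname{dom}\kappa^*\cap\mathcal L_+(P,K)$, $T_2\in\mathcal L_+(S,K)$ of the sets $$-\big[F^*(L')\uplus(T_1\circ H+T_2\circ G+I_C)^*(L-L')\uplus\kappa^*(T_1)\big].$$ Then $(\mathrm a_2)\Leftrightarrow(\mathrm e_2)$ and $(\mathrm b_2)\Leftrightarrow(\mathrm f_2)$.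
   Context: Ordering: $K$ proper means $K\neq Y$. $y_1<_K y_2$ iff $y_1-y_2\in-\operatorname{int}K$. $Y^\infty=Y\cup\{+\infty_Y\}$, $Y^\bullet=Y\cup\{\pm\infty_Y\}$, with $-\infty_Y<_Ky<_K+\infty_Y$ for $y\in Y$, $-\infty_Y<_K+\infty_Y$, $-(\pm\infty_Y)=\mp\infty_Y$, $y+(+\infty_Y)=+\infty_Y$ for $y\in Y^\infty$, $M+\{+\infty_Y\}=\{+\infty_Y\}$ for $M\subset Y$; similarly $W^\infty=W\cup\{+\infty_W\}$, $Z^\infty=Z\cup\{+\infty_Z\}$. For $M\subset Y^\bullet$: $\operatorname{WSup}M$ is the set of $\bar v\in Y^\bullet$ such that $\bar v\not<_Kv$ for all $v\in M$ and for every $\tilde v\in Y^\bullet$ with $\tilde v<_K\bar v$ there is $v\in M$ with $\tilde v<_Kv$; $\operatorname{WInf}M=-\operatorname{WSup}(-M)$; $\operatorname{WMax}M=M\cap\operatorname{WSup}M$. A mapping into $Y^\infty$ (or $W^\infty$, $Z^\infty$) is proper if its domain (set of points where it is not $+\infty$) is nonempty. $\kappa(+\infty_W)=+\infty_Y$. For $T\in\mathcal L(Z,Y)$ (continuous linear maps), $(T\circ G)(x)=T(G(x))$ if $G(x)\in Z$ and $+\infty_Y$ otherwise; likewise $T\circ H$. $I_D(x)=0_Y$ if $x\in D$, $+\infty_Y$ otherwise. $0_{\mathcal L}$ is the zero of $\mathcal L(X,Y)$. $\mathcal L_+(S,K)=\{T\in\mathcal L(Z,Y):T(S)\subset K\}$,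 $\mathcal L_+^w(S,K)=\{T\in\mathcal L(Z,Y):T(S)\cap(-\operatorname{int}K)=\emptyset\}$, and $\mathcal L_+(P,K)$ is defined analogously. Conjugates: for $E\colon X\to Y^\infty$, $E^*(L)=\operatorname{WSup}\{L(x)-E(x):x\in X\}$, $\operatorname{dom}E^*=\{L:E^*(L)\neq\{+\infty_Y\}\}$, $\operatorname{epi}E^*=\{(L,y)\in\mathcal L(X,Y)\times Y:y\in E^*(L)+K\}$; likewise for mappings on $W$, $Z$ ($\kappa^*$, $I_{-S}^*$). Set order: for nonempty $M,N\subset Y^\bullet$, $M\preccurlyeq_KN$ iff $v\not<_Ku$ for all $u\in M$, $v\in N$. $\mathcal P_p(Y)$ is the collection of $U\subset Y$ such that $Y$ is the disjoint union of $U-\operatorname{int}K$, $U$, $U+\operatorname{int}K$; $\mathcal P_p(Y)^\infty=\mathcal P_p(Y)\cup\{\{+\infty_Y\}\}$. For $U,V\in\mathcal P_p(Y)^\infty$, $U\uplus V=\operatorname{WSup}(U+V)$ (a commutative, associative operation). Extended epigraph: $\mathfrak E\mathrm{pi}E^*=\{(L,U)\in\mathcal L(X,Y)\times\mathcal P_p(Y):L\in\operatorname{dom}E^*,\ E^*(L)\preccurlyeq_KU\}$. $\mathscr M\boxplus\mathscr N=\{(L_1+L_2,U_1\uplus U_2):(L_1,U_1)\in\mathscr M,(L_2,U_2)\in\mathscr N\}$. $\Psi$ is the set-valued map from $\mathcal L(X,Y)\times\mathcal P_p(Y)$ to $\mathcal L(X,Y)\times Y$ given by $\Psi(L,U)=\{L\}\times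 U$, and $\Psi(\mathscr M)=\bigcup_{(L,U)\in\mathscr M}\Psi(L,U)$. $(\mathrm{CCVP})$ is the problem $\operatorname{WInf}\{F(x)+(\kappa\circ H)(x):x\in C,\ G(x)\in-S\}$; $(\mathrm{CCVD}^2)$ and $(\mathrm{CCVD}^2_\ell)$ are its Fenchel-Lagrange duals, obtained from $D_L$ and $D_L^+$ with $L=0_{\mathcal L}$.
   Formalization: Each equivalence is stated assuming that dom κ* (for (b₂)⇔(f₂): dom κ*∩L_+(P,K)) or epi(F+κ∘H+I_A)* is nonempty; if both are empty, (a₂) or (b₂) holds as ∅=∅ while (e₂) or (f₂) fails, since WMax ∅=∅ but the WInf is {−∞}. *)

(* Defs.v *)
From HB Require Import structures.
From mathcomp Require Import all_boot all_order all_algebra.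
From mathcomp Require Import all_classical all_reals all_analysis.

Set Implicit Arguments.
Unset Strict Implicit.
Unset Printing Implicit Defensive.

Import Order.TTheory GRing.Theory Num.Theory.
Local Open Scope classical_set_scope.
Local Open Scope ring_scope.

(* Y with both infinities adjoined is [\bar Y]: the library's [extended] takes
   any type, and its [adde] and [oppe] only need an additive group.  A mapping
   into Y^oo is a function into [\bar Y] that avoids -oo, so the library's
   convention +oo + -oo = -oo is never used below. *)

Section cones_and_maps.
Context {R : realType} {U V : tvsType R}.

(* The scalars are only required to be positive, so 0 need not belong to C. *)
Definition convex_cone (C : set V) : Prop :=
  convex_set C /\ forall (t : R) x, 0 < t -> C x -> C (t *: x).

Definition opp_set (C : set V) : set V := [set - x | x in C].

(* L(U, V), as a subset of the group of all functions U -> V *)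
Definition clin : set (U -> V) :=
  [set T | linear T /\ continuous T].

Definition L_plus (S : set U) (K : set V) : set (U -> V) :=
  [set T | clin T /\ T @` S `<=` K].

Definition L_plus_w (S : set U) (K : set V) : set (U -> V) :=
  [set T | clin T /\ T @` S `&` opp_set (interior K) = set0].

End cones_and_maps.

Section extended_maps.
Context {X U V : Type}.

Definition into_infty (f : X -> \bar V) : Prop := forall x, f x <> -oo%E.

Definition dom (f : X -> \bar V) : set X := [set x | f x <> +oo%E].

Definition comp_infty (f : U -> \bar V) (h : X -> \bar U) (x : X) : \bar V :=
  match h x with
  | EFin u => f u
  | _ => +oo%E
  end.

End extended_maps.

Definition proper_map {X V : Type} (f : X -> \bar V) : Prop :=
  into_infty f /\ dom f !=set0.

Definition indic_map {X : Type} {V : zmodType} (D : set X) (x : X) : \bar V :=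
  if `[< D x >] then (0 : V)%:E else +oo%E.

Section vector_order.
Context {R : realType} {Y : tvsType R} (K : set Y).

Definition ltK (u v : \bar Y) : Prop :=
  match u, v with
  | EFin y1, EFin y2 => opp_set (interior K) (y1 - y2)
  | ENInf, EFin _ => True
  | ENInf, EPInf => True
  | EFin _, EPInf => True
  | _, _ => False
  end.

Definition WSup (M : set (\bar Y)) : set (\bar Y) :=
  [set v | (forall u, M u -> ~ ltK v u) /\
           (forall w, ltK w v -> exists2 u, M u & ltK w u)].

Definition WInf (M : set (\bar Y)) : set (\bar Y) :=
  oppe @` WSup (oppe @` M).

Definition WMax (M : set (\bar Y)) : set (\bar Y) := M `&` WSup M.

Definition sum_ext (M N : set (\bar Y)) : set (\bar Y) :=
  [set (u + v)%E | u in M & v in N].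

Definition uplus (M N : set (\bar Y)) : set (\bar Y) := WSup (sum_ext M N).

Definition preceqK (M N : set (\bar Y)) : Prop :=
  forall u v, M u -> N v -> ~ ltK v u.

Definition P_p : set (set Y) :=
  [set U | let lower := [set u - k | u in U & k in interior K] in
           let upper := [set u + k | u in U & k in interior K] in
           [/\ lower `|` U `|` upper = setT,
               lower `&` U = set0,
               U `&` upper = set0 &
               lower `&` upper = set0]].

Section conjugates.
Context {X : tvsType R} (E : X -> \bar Y).

Definition conjugate (L : X -> Y) : set (\bar Y) :=
  WSup (range (fun x => (L x)%:E - E x)%E).

Definition dom_conj : set (X -> Y) :=
  [set L | clin L /\ conjugate L <> [set +oo%E]].

Definition epi_conj : set ((X -> Y) * Y) :=
  [set p | clin p.1 /\ sum_ext (conjugate p.1) (EFin @` K) p.2%:E].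

(* The second component is U in P_p(Y), embedded in the subsets of [\bar Y]. *)
Definition Epi_conj : set ((X -> Y) * set (\bar Y)) :=
  [set p | [/\ (exists2 U, P_p U & p.2 = EFin @` U),
               dom_conj p.1 & preceqK (conjugate p.1) p.2]].

End conjugates.

Section extended_epigraphs.
Context {X : tvsType R}.

Definition boxplus (M N : set ((X -> Y) * set (\bar Y))) :
    set ((X -> Y) * set (\bar Y)) :=
  [set (p.1 + q.1, uplus p.2 q.2) | p in M & q in N].

(* U1 (+) U2 can be {+oo} for U1, U2 in P_p(Y); as Psi takes its values in
   L(X,Y) x Y, such a pair contributes nothing. *)
Definition Psi (M : set ((X -> Y) * set (\bar Y))) : set ((X -> Y) * Y) :=
  [set q | exists2 U, M (q.1, U) & U q.2%:E].

End extended_epigraphs.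

End vector_order.

Section composite_problem.
Context {R : realType} {X Y Z W : tvsType R}.
Variables (K : set Y) (P : set W) (S : set Z).
Variables (F : X -> \bar Y) (kappa : W -> \bar Y).
Variables (H : X -> \bar W) (G : X -> \bar Z) (C : set X).

Definition feasible : set X := C `&` G @^-1` (EFin @` opp_set S).

Definition objective (x : X) : \bar Y := (F x + comp_infty kappa H x)%E.

Definition constrained_objective (x : X) : \bar Y :=
  (objective x + indic_map feasible x)%E.

Definition scalarized (T1 : W -> Y) (T2 : Z -> Y) (x : X) : \bar Y :=
  (comp_infty (EFin \o T1) H x + comp_infty (EFin \o T2) G x
   + indic_map C x)%E.

Definition conj_ind (T2 : Z -> Y) : set (\bar Y) :=
  conjugate K (indic_map (opp_set S)) T2.

Definition M2 : set ((X -> Y) * Y) :=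
  \bigcup_(T1 in dom_conj K kappa) \bigcup_(T2 in L_plus_w S K)
    Psi (boxplus K
          (boxplus K (Epi_conj K F) (Epi_conj K (scalarized T1 T2)))
          [set (0, uplus K (conjugate K kappa T1) (conj_ind T2))]).

Definition M2_plus : set ((X -> Y) * Y) :=
  \bigcup_(T1 in dom_conj K kappa `&` L_plus P K)
  \bigcup_(T2 in L_plus S K)
    Psi (boxplus K
          (boxplus K (Epi_conj K F) (Epi_conj K (scalarized T1 T2)))
          [set (0, conjugate K kappa T1)]).

Definition dual_union (L : X -> Y) : set (\bar Y) :=
  \bigcup_(L' in clin) \bigcup_(T1 in dom_conj K kappa)
  \bigcup_(T2 in L_plus_w S K)
    oppe @` (uplus K
              (uplus K
                (uplus K (conjugate K F L') (conjugate K (scalarized T1 T2) (L - L')))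
                (conjugate K kappa T1))
              (conj_ind T2)).

Definition dual_union_plus (L : X -> Y) : set (\bar Y) :=
  \bigcup_(L' in clin) \bigcup_(T1 in dom_conj K kappa `&` L_plus P K)
  \bigcup_(T2 in L_plus S K)
    oppe @` (uplus K
              (uplus K (conjugate K F L') (conjugate K (scalarized T1 T2) (L - L')))
              (conjugate K kappa T1)).

Definition stable_strong_duality (dual : (X -> Y) -> set (\bar Y)) : Prop :=
  forall L : X -> Y, clin L ->
    WInf K [set (objective x - (L x)%:E)%E | x in feasible]
    = WMax K (dual L).

End composite_problem.

(* Main.v *)
(* Put lo M = {y in Y | y <_K u for some u in M}. Then WSup M depends only on
   lo M, being its upper boundary (or {+oo}, {-oo} when lo M is Y or empty);
   moreover lo (WSup M) = lo M and lo turns (+) into the Minkowski sum. If E is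
   proper, (L, y) lies in epi E^* iff y is not in lo (E^* L), because one can
   descend from such a y along an interior direction of K until the boundary
   is met. In the same way M2 consists of the (L, y) with y outside
   lo (F^* L') + lo ((T1 o H + T2 o G + I_C)^* (L - L')) + ... for some choice
   of L', T1, T2: the descent needed to reach the boundary is absorbed by
   enlarging F^* L', which extended epigraphs allow. Weak duality says that
   each of these open sets contains lo ((F + kappa o H + I_A)^* L), so the
   epigraph identity says that their intersection equals it, and this is
   exactly attainment in the dual problem at every L. *)

Require Import Defs.
From HB Require Import structures.
From mathcomp Require Import all_boot all_order all_algebra.
From mathcomp Require Import all_classical all_reals all_analysis.

Set Implicit Arguments.
Unset Strict Implicit.
Unset Printing Implicit Defensive.

Import Order.TTheory GRing.Theory Num.Theory.
Local Open Scope classical_set_scope.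
Local Open Scope ring_scope.

(** * Continuous linear maps form a group *)

Lemma clinD {R : realType} {U V : tvsType R} (f g : U -> V) :
  clin f -> clin g -> clin (f + g).
Proof.
move=> -[lf cf] [lg cg]; split=> [a u v|x].
  by rewrite !fctE lf lg scalerDr addrACA.
apply: (@continuous_comp _ _ _ (fun x => (f x, g x))
  (fun p : V * V => p.1 + p.2)).
  exact: cvg_pair (cf x) (cg x).
exact: add_continuous.
Qed.

Lemma clinN {R : realType} {U V : tvsType R} (f : U -> V) :
  clin f -> clin (- f).
Proof.
move=> -[lf cf]; split=> [a u v|x].
  by change (- f (a *: u + v) = a *: (- f u) + (- f v));
    rewrite lf opprD scalerN.
by apply: (@continuous_comp _ _ _ f -%R); [exact: cf|exact: opp_continuous].
Qed.

Lemma clin0 {R : realType} {U V : tvsType R} : clin (0 : U -> V).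
Proof.
split=> [a u v|x]; last exact: cvg_cst.
by change (0 = a *: (0 : V) + 0); rewrite scaler0 addr0.
Qed.

(** * The ordering cone and its interior *)

Section ordering_cone.
Context {R : realType} {Y : tvsType R} (K : set Y).
Hypotheses (K_cone : convex_cone K) (K_closed : closed K).
Hypotheses (K_int : interior K !=set0) (K_proper : K <> setT).

(** The sum is twice the midpoint of x and y. *)
Lemma coneD x y : K x -> K y -> K (x + y).
Proof.
have [K_conv K_scale] := K_cone => Kx Ky.
have half01 : 0 <= (2^-1 : R) <= 1 by rewrite invr_ge0 ler0n invf_le1 ?ler1n.
have [half0 half1] := andP half01.
have := K_conv x y (Itv01 half0 half1).
rewrite !inE => /(_ Kx Ky) /(K_scale 2 _ (ltr0n _ _)).
rewrite /conv/= scalerDr !scalerA /unstable.onem.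
rewrite mulrBr mulfV ?pnatr_eq0// mulr1 scale1r.
by rewrite (_ : 2 - 1 = 1 :> R) ?scale1r// (natrD _ 1 1) addrK.
Qed.

Lemma interior_coneD x y : K x -> interior K y -> interior K (x + y).
Proof.
move=> Kx Ky; apply: filterS (nbhsB_subproof add_continuous x Ky).
by move=> _ [z Kz <-]; exact: coneD.
Qed.

Lemma interior_coneZ (t : R) x :
  0 < t -> interior K x -> interior K (t *: x).
Proof.
move=> t0 Kx.
have /= := @scale_continuous R Y (t^-1, t *: x) K.
rewrite scalerA mulVf ?gt_eqF// scale1r => /(_ Kx)[[A B] /= [At Bx] AB].
apply: filterS Bx => z Bz.
have /= := AB (t^-1, z) (conj (nbhs_singleton At) Bz).
by move=> /(proj2 K_cone t _ t0); rewrite scalerA mulfV ?gt_eqF// scale1r.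
Qed.

(** The continuous curve x - s y starts in the open set int K at s = 0, so it stays there for small
    s > 0. *)
Lemma interior_cone_absorb x y :
  interior K x -> exists2 s : R, 0 < s & interior K (x - s *: y).
Proof.
move=> Kx.
have cf : continuous (fun s : R^o => x + s *: (- y)).
  move=> s.
  apply: (@continuous_comp _ _ _ (fun s : R^o => (x, s *: (- y)))
    (fun p : Y * Y => p.1 + p.2)); last exact: add_continuous.
  apply: cvg_pair; first exact: cvg_cst.
  apply: (@continuous_comp _ _ _ (fun s : R^o => (s, - y))
    (fun p : R^o * Y => p.1 *: p.2)); last exact: scale_continuous.
  exact: (cvg_pair cvg_id (cvg_cst _)).
have /(cf 0) /nbhs_ballP[r /= r0 rK] :
    nbhs (x + (0 : R) *: - y) (interior K).
  by rewrite scale0r addr0; exact: nbhs_interior.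
exists (r / 2); first exact: divr_gt0.
rewrite -scalerN; apply: rK.
by rewrite /ball/= sub0r normrN gtr0_norm ?divr_gt0// ltr_pdivrMr//
  ltr_pMr// ltr1n.
Qed.

(** Scaling is only by positive numbers, so 0 comes from closedness, as the limit of s e with e in
    int K and s decreasing to 0. *)
Lemma cone0 : K 0.
Proof.
have [e Ke] := K_int; apply: K_closed => B B0.
have cf : continuous (fun s : R^o => s *: e).
  move=> s.
  apply: (@continuous_comp _ _ _ (fun s : R^o => (s, e))
    (fun p : R^o * Y => p.1 *: p.2)); last exact: scale_continuous.
  exact: (cvg_pair cvg_id (cvg_cst _)).
have /(cf 0) /nbhs_ballP[r /= r0 rB] : nbhs ((0 : R) *: e) B by rewrite scale0r.
exists ((r / 2) *: e); split.
  by apply: (proj2 K_cone); [exact: divr_gt0|exact: interior_subset].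
apply: rB.
by rewrite /ball/= sub0r normrN gtr0_norm ?divr_gt0// ltr_pdivrMr//
  ltr_pMr// ltr1n.
Qed.

(** If 0 were interior, K would absorb every direction and hence, after rescaling, contain every
    y. *)
Lemma interior_cone_neq0 : ~ interior K 0.
Proof.
move=> K0; apply: K_proper; apply/seteqP; split=> // y _.
have [s s0 /interior_subset] := interior_cone_absorb (- y) K0.
rewrite scalerN opprK add0r => /(proj2 K_cone s^-1 _).
by rewrite invr_gt0 scalerA mulVf ?gt_eqF// scale1r => /(_ s0).
Qed.


(** * Lower-open sets and their upper boundaries *)

Definition lower_open (D : set Y) : Prop :=
  forall y, D y <-> exists2 k, interior K k & D (y + k).

Definition upper_boundary (D : set Y) : set Y :=
  [set v | ~ D v /\ forall k, interior K k -> D (v - k)].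

(** This is lo M: an element +oo of M makes it all of Y, an element -oo adds nothing. *)
Definition strict_lower (M : set (\bar Y)) : set Y :=
  [set y | exists2 u, M u & ltK K y%:E u].

Definition minkowski (A B : set Y) : set Y := [set a + b | a in A & b in B].

Lemma interior_cone_absorbing e y :
  interior K e -> exists2 r : R, 0 < r & interior K (r *: e - y).
Proof.
move=> /(interior_cone_absorb y)[s s0 Ks]; exists s^-1;
  first by rewrite invr_gt0.
have := interior_coneZ (t := s^-1) _ Ks; rewrite invr_gt0 => /(_ s0).
by rewrite scalerBr scalerA mulVf ?gt_eqF// scale1r.
Qed.

(** Lower openness is the equation D = D - int K; since K + int K lies in int K, it also gives
    closure under subtracting K. *)
Lemma lower_open_downward D y k : lower_open D -> K k -> D (y + k) -> D y.
Proof.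
move=> Do Kk /Do[k' Kk' Dk]; apply/Do; exists (k + k'); last by rewrite addrA.
exact: interior_coneD.
Qed.

Lemma cone_ray e (t : R) : interior K e -> 0 <= t -> K (t *: e).
Proof.
move=> Ke; rewrite le_eqVlt => /predU1P[<-|t0].
  by rewrite scale0r; exact: cone0.
by apply: (proj2 K_cone) => //; exact: interior_subset.
Qed.

(** The length t is the infimum of the s with y - s e in D. Such s exist because e absorbs every
    vector, and none is negative because y is outside the downward closed D. *)
Lemma upper_boundary_ray D e y : lower_open D -> interior K e ->
  D !=set0 -> ~ D y -> exists2 t : R, 0 <= t & upper_boundary D (y - t *: e).
Proof.
move=> Do Ke [d Dd] nDy.
have KZ (t : R) : 0 <= t -> K (t *: e) by exact: cone_ray.
pose A := [set s : R | D (y - s *: e)].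
have A0 : A !=set0.
  have [r r0 Kr] := interior_cone_absorbing (y - d) Ke.
  exists r; rewrite /A/=.
  apply: (lower_open_downward (k := r *: e - (y - d)) Do).
    exact: interior_subset.
  by rewrite opprB addrA subrK addrC subrK.
have lbA : lbound A 0.
  move=> s As; rewrite leNgt; apply/negP => s0; apply: nDy.
  apply: (lower_open_downward (k := (- s) *: e) Do).
    by apply: KZ; rewrite oppr_ge0 ltW.
  by rewrite scaleNr.
have infA : has_inf A by split=> //; exists 0.
exists (inf A); first exact: lb_le_inf.
split=> [/Do[k Kk]|k Kk].
  (* Lower openness leaves room k above the point; spending s e of it would put [inf A - s] into
     A. *)
  have [s s0 Ks] := interior_cone_absorb e Kk => Dk.
  suff : inf A <= inf A - s by rewrite lerBrDr gerDl leNgt s0.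
  apply: ge_inf; first by exists 0.
  rewrite /A/=; apply: (lower_open_downward (k := k - s *: e) Do).
    exact: interior_subset.
  move: Dk; congr D; rewrite scalerBl opprB -!addrA; congr (y + _).
  by rewrite addrCA subrKC addrC.
have [s s0 Ks] := interior_cone_absorb e Kk.
(* The part s e of k covers the excess of a over the infimum. *)
have [a Aa ainf] := inf_adherent s0 infA.
apply: (lower_open_downward (k := (s - (a - inf A)) *: e + (k - s *: e)) Do).
  apply: coneD; last exact: interior_subset.
  by apply: KZ; rewrite subr_ge0 lerBlDl ltW.
move: Aa; rewrite /A/=; congr D.
rewrite !scalerBl [_ - _ + (k - _)]addrC !addrA !subrK.
by rewrite opprB addrA subrK.
Qed.

(** Climb from w along e until outside D, then descend to the boundary. The net move (r - t) e is
    upward, since otherwise the boundary point would lie in D. *)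
Lemma upper_boundary_above D w : lower_open D -> D w -> D <> setT ->
  exists2 v, upper_boundary D v & interior K (v - w).
Proof.
move=> Do Dw DT; have [e Ke] := K_int.
have [y nDy] : exists y, ~ D y.
  apply: contrapT => /forallNP DA; apply: DT; apply/seteqP; split=> // y _.
  exact: contrapT (DA y).
have [r r0 Kr] := interior_cone_absorbing (y - w) Ke.
have nDr : ~ D (w + r *: e).
  move=> Dr; apply: nDy.
  apply: (lower_open_downward (k := r *: e - (y - w)) Do).
    exact: interior_subset.
  by move: Dr; congr D; rewrite opprB addrCA [y + _]addrCA subrr addr0 addrC.
have [t t0 Dt] := upper_boundary_ray Do Ke (ex_intro _ _ Dw) nDr.
exists (w + r *: e - t *: e) => //.
have wrt : w + r *: e - t *: e = w + (r - t) *: e by rewrite scalerBl addrA.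
rewrite wrt [w + _]addrC addrK; apply: interior_coneZ => //.
rewrite ltNge; apply/negP => rt; apply: (proj1 Dt).
rewrite wrt; move: rt; rewrite le_eqVlt => /predU1P[->|rt].
  by rewrite scale0r addr0.
apply: (lower_open_downward (k := (t - r) *: e) Do).
  by apply: (proj2 K_cone); [rewrite subr_gt0 -subr_lt0|exact: interior_subset].
by rewrite -addrA -scalerDl addrA subrK subrr scale0r addr0.
Qed.

(** * Weak suprema through their strict lower sets *)

Lemma ltK_fin a b : ltK K a%:E b%:E <-> interior K (b - a).
Proof.
rewrite /ltK /opp_set /=; split=> [[k Kk ka]|Kba].
  by rewrite -opprB -ka opprK.
by exists (b - a); rewrite ?opprB.
Qed.

(** Below a finite u the room above y is half of the interior vector u - y; below +oo any interior
    vector serves. *)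
Lemma strict_lower_open M : lower_open (strict_lower M).
Proof.
have [e Ke] := K_int.
move=> y; split=> [[[u||] Mu yu]|[k Kk [[u||] Mu yu]]] //.
- move/ltK_fin: yu => yu.
  have Kh : interior K (2^-1 *: (u - y)).
    by apply: interior_coneZ; rewrite ?invr_gt0.
  exists (2^-1 *: (u - y)) => //; exists u%:E => //; apply/ltK_fin.
  move: Kh; congr (interior K); apply/eqP.
  rewrite opprD addrA eq_sym subr_eq -scalerDl.
  by rewrite -[2^-1]div1r -splitr scale1r.
- by exists e => //; exists +oo%E.
- exists u%:E => //; apply/ltK_fin; move/ltK_fin: yu => yu.
  rewrite (_ : u - y = k + (u - (y + k))); last first.
    by rewrite opprD addrCA [k + _]addrCA subrr addr0.
  exact: interior_coneD (interior_subset Kk) yu.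
- by exists +oo%E.
Qed.

Lemma WSup_fin M v : WSup K M v%:E <-> upper_boundary (strict_lower M) v.
Proof.
have [e Ke] := K_int.
split=> -[nv bv]; split.
- by case=> u Mu; exact: nv.
- move=> k Kk; apply: (bv (v - k)%:E); apply/ltK_fin.
  by rewrite opprB addrC subrK.
- by move=> u Mu vu; apply: nv; exists u.
- case=> [w||] //.
  + by move=> /ltK_fin Kvw; move: (bv _ Kvw); rewrite opprB addrC subrK.
  (* For w = -oo, an element of M above v - e is also above -oo. *)
  + by move=> _; have [[u||] Mu // vu] := bv _ Ke; [exists u%:E|exists +oo%E].
Qed.

Lemma WSup_pinfty M : WSup K M +oo%E <-> strict_lower M = setT.
Proof.
split=> [[_ bM]|MT].
  by apply/seteqP; split=> // y _; exact: (bM y%:E).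
split=> [? ? []//|[w||]// _].
- by have : strict_lower M w by rewrite MT.
- have : strict_lower M 0 by rewrite MT.
  by case=> -[u||] Mu // _; [exists u%:E|exists +oo%E].
Qed.

Lemma WSup_ninfty M : WSup K M -oo%E <-> strict_lower M = set0.
Proof.
have [e Ke] := K_int.
split=> [[nM _]|M0].
  apply/seteqP; split=> // y [[u||] Mu //= _].
  - exact: (nM _ Mu).
  - exact: (nM _ Mu).
split=> [[u||] Mu //= _|[]//].
- have : strict_lower M (u - e); last by rewrite M0.
  by exists u%:E => //; apply/ltK_fin; rewrite opprB addrC subrK.
- by have : strict_lower M 0; [exists +oo%E|rewrite M0].
Qed.

Lemma eq_WSup M N : strict_lower M = strict_lower N -> WSup K M = WSup K N.
Proof.
by move=> MN; apply/seteqP; split=> -[v||];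
  rewrite ?WSup_fin ?WSup_pinfty ?WSup_ninfty MN.
Qed.

(** A point of lo M lies strictly below a boundary point of lo M, or below +oo when lo M is all of
    Y. *)
Lemma strict_lower_WSup M : strict_lower (WSup K M) = strict_lower M.
Proof.
apply/seteqP; split=> y.
  case=> -[u||] //.
  + move=> /WSup_fin[_ bu] /ltK_fin Kuy.
    by move: (bu _ Kuy); rewrite opprB addrC subrK.
  + by move=> /WSup_pinfty ->.
move=> My; have [MT|MT] := pselect (strict_lower M = setT).
  by exists +oo%E => //; apply/WSup_pinfty.
have [v /WSup_fin Mv Kvy] :=
  upper_boundary_above (@strict_lower_open M) My MT.
by exists v%:E => //; apply/ltK_fin.
Qed.

(** For finite u and v the gap u + v - y is shared equally. If one term is +oo, the part below it
    takes whatever remainder is left. A sum with -oo is -oo and contributes to neither side. *)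
Lemma strict_lower_sum_ext M N :
  strict_lower (sum_ext M N) = minkowski (strict_lower M) (strict_lower N).
Proof.
have [e Ke] := K_int.
have Ku (u : Y) : ltK K (u - e)%:E u%:E.
  by apply/ltK_fin; rewrite opprB addrC subrK.
apply/seteqP; split=> y.
  case=> _ [[u||] Mu [[v||] Nv <-]] //=.
  - move=> /ltK_fin Kuv.
    have Kh : interior K (2^-1 *: (u + v - y)).
      by apply: interior_coneZ; rewrite ?invr_gt0.
    exists (u - 2^-1 *: (u + v - y)).
      by exists u%:E => //; apply/ltK_fin; rewrite opprB addrC subrK.
    exists (v - 2^-1 *: (u + v - y)).
      by exists v%:E => //; apply/ltK_fin; rewrite opprB addrC subrK.
    rewrite addrACA -opprD -scalerDl.
    rewrite -[2^-1]div1r -splitr scale1r opprB addrC subrK.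
    by [].
  - move=> _; exists (u - e); first by exists u%:E.
    by exists (y - (u - e)); [exists +oo%E|rewrite addrC subrK].
  - move=> _; exists (y - (v - e)); first by exists +oo%E.
    by exists (v - e); [exists v%:E|rewrite subrK].
  - move=> _; exists y; first by exists +oo%E.
    by exists 0; [exists +oo%E|rewrite addr0].
case=> a [[u||] Mu //= au] [b [[v||] Nv //= bv] <-].
- exists (u + v)%:E; first by exists u%:E => //; exists v%:E.
  move/ltK_fin: au => au; move/ltK_fin: bv => bv; apply/ltK_fin.
  by rewrite opprD addrACA; exact: interior_coneD (interior_subset au) bv.
- by exists +oo%E => //; exists u%:E => //; exists +oo%E.
- by exists +oo%E => //; exists +oo%E => //; exists v%:E.
- by exists +oo%E => //; exists +oo%E => //; exists +oo%E.
Qed.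

Lemma strict_lower_uplus M N : strict_lower (uplus K M N) =
  minkowski (strict_lower M) (strict_lower N).
Proof. by rewrite strict_lower_WSup strict_lower_sum_ext. Qed.

(** * Minkowski sums of lower sets *)

Lemma minkowskiC A B : minkowski A B = minkowski B A.
Proof.
apply/seteqP; split=> _ [a Aa [b Bb <-]];
by exists b => //; exists a; rewrite 1?addrC.
Qed.

Lemma minkowskiA A B D :
  minkowski A (minkowski B D) = minkowski (minkowski A B) D.
Proof.
apply/seteqP; split.
  move=> _ [a Aa [_ [b Bb [d Dd <-]] <-]]; exists (a + b).
    by exists a => //; exists b.
  by exists d; rewrite ?addrA.
move=> _ [_ [a Aa [b Bb <-]] [d Dd <-]]; exists a => //; exists (b + d).
  by exists b => //; exists d.
by rewrite addrA.
Qed.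

Lemma minkowski_sub A A' B B' :
  A `<=` A' -> B `<=` B' -> minkowski A B `<=` minkowski A' B'.
Proof.
move=> AA BB _ [a Aa [b Bb <-]]; exists a; first exact: AA.
by exists b => //; exact: BB.
Qed.

Lemma minkowski_neq0 A B :
  A !=set0 -> B !=set0 -> minkowski A B !=set0.
Proof. by move=> [a Aa] [b Bb]; exists (a + b); exists a => //; exists b. Qed.

Lemma minkowskiT A : A !=set0 -> minkowski A setT = setT.
Proof.
move=> [a Aa]; apply/seteqP; split=> // y _.
by exists a => //; exists (y - a); rewrite ?subrKC.
Qed.

Lemma interior_cone_half k : interior K k ->
  exists2 h, interior K h & k = h + h.
Proof.
move=> Kk; exists (2^-1 *: k).
  by apply: interior_coneZ; rewrite ?invr_gt0.
by rewrite -scalerDl -[2^-1]div1r -splitr scale1r.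
Qed.

(** The lower set of {k} is k - int K, so adding it to D = D - int K just translates D by k. *)
Lemma translate_upper_boundary D k y :
  lower_open D -> upper_boundary D (y - k) ->
  upper_boundary (minkowski D (strict_lower [set k%:E])) y.
Proof.
move=> Do [nDy bDy]; split.
  move=> [d Dd [b [_ -> /ltK_fin Kkb] dby]]; apply: nDy.
  apply: (lower_open_downward (k := k - b) Do); first exact: interior_subset.
  by rewrite addrA subrK -dby addrK.
move=> _ /interior_cone_half[h Kh ->].
exists (y - k - h); first exact: bDy.
exists (k - h).
  by exists k%:E => //; apply/ltK_fin; rewrite opprB addrC subrK.
by rewrite addrACA subrK opprD.
Qed.

(** * Members of [P_p] and their lower sets *)

Lemma strict_lower_EFin (U : set Y) : strict_lower (EFin @` U) =
  [set u - k | u in U & k in interior K].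
Proof.
apply/seteqP; split=> y.
  case=> _ [u Uu <-] /ltK_fin Kuy.
  by exists u => //; exists (u - y); rewrite // opprB addrC subrK.
case=> u Uu [k Kk <-]; exists u%:E; first by exists u.
by apply/ltK_fin; rewrite opprB addrC subrK.
Qed.

(** The lower part is D itself. A point outside D descends to the boundary by some t e: it is on the
    boundary if t = 0 and in the upper part if t > 0. *)
Lemma upper_boundary_P_p D : lower_open D -> D !=set0 -> D <> setT ->
  P_p K (upper_boundary D).
Proof.
move=> Do D0 DT; have [e Ke] := K_int; rewrite /P_p /=.
set lo := [set _ - _ | _ in _ & _ in _];
set up := [set _ + _ | _ in _ & _ in _].
have loE : lo = D.
  apply/seteqP; split=> w; first by case=> u [_ bu] [k Kk <-]; exact: bu.
  move=> Dw; have [v Dv Kvw] := upper_boundary_above Do Dw DT.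
  by exists v => //; exists (v - w); rewrite // opprB addrC subrK.
have upD : D `&` up = set0.
  apply/seteqP; split=> // y [Duk [u [nDu _] [k Kk uk]]]; apply: nDu.
  by apply: (lower_open_downward Do (interior_subset Kk)); rewrite uk.
split; rewrite ?loE //.
- apply/seteqP; split=> // y _.
  have [Dy|nDy] := pselect (D y); first by left; left.
  have [t t0 bt] := upper_boundary_ray Do Ke D0 nDy.
  move: t0; rewrite le_eqVlt => /predU1P[t0|t0].
    by left; right; move: bt; rewrite -t0 scale0r subr0.
  right; exists (y - t *: e) => //; exists (t *: e); last exact: subrK.
  exact: interior_coneZ.
- by apply/seteqP; split=> // y [Dy []].
- apply/seteqP; split=> // y [[_ buk] [u [nDu _] [k Kk uk]]]; apply: nDu.
  by move: (buk _ Kk); rewrite -uk addrK.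
Qed.

Lemma WSup_P_p N : strict_lower N !=set0 -> strict_lower N <> setT ->
  exists2 U, P_p K U & WSup K N = EFin @` U.
Proof.
move=> N0 NT; exists (upper_boundary (strict_lower N)).
  by apply: upper_boundary_P_p => //; exact: strict_lower_open.
apply/seteqP; split=> [[v||]|_ [v bv <-]].
- by move=> /WSup_fin bv; exists v.
- by move=> /WSup_pinfty.
- by move=> /WSup_ninfty N0'; case: N0 => y; rewrite N0'.
- exact/WSup_fin.
Qed.

(** U avoids lo M, and so does U + int K because lo M is downward closed; of the three parts of Y
    only U - int K is left. *)
Lemma preceqK_strict_lower M U : P_p K U ->
  preceqK K M (EFin @` U) -> strict_lower M `<=` strict_lower (EFin @` U).
Proof.
move=> [UT _ _ _] MU y My.
have nMU u : U u -> ~ strict_lower M u.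
  by move=> Uu [v Mv uv]; apply: (MU v u%:E Mv) => //; exists u.
rewrite strict_lower_EFin.
have : setT y by []. rewrite -UT => -[[//|Uy]|[u Uu [k Kk uky]]].
  by case: (nMU _ Uy).
case: (nMU _ Uu); apply: (lower_open_downward (k := k) (@strict_lower_open M)).
  exact: interior_subset.
by rewrite uky.
Qed.

(** * Conjugates, epigraphs and extended epigraphs *)

Section conjugate_theory.
Context {X : tvsType R}.
Implicit Types (E : X -> \bar Y) (L : X -> Y).

(** Points where E is +oo put -oo into the range, which adds nothing to the lower set. *)
Lemma strict_lower_conjP E L y : into_infty E ->
  strict_lower (conjugate K E L) y <->
  exists x r, E x = r%:E /\ interior K (L x - r - y).
Proof.
move=> Einf; rewrite strict_lower_WSup; split.
  case=> _ [x _ <-]; case Ex : (E x) => [r||] //=.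
    by move=> /ltK_fin ?; exists x, r.
  by move: (Einf x); rewrite Ex.
move=> [x [r [Ex Kx]]]; exists (L x - r)%:E; last exact/ltK_fin.
by exists x => //; rewrite Ex.
Qed.

(** This is the Fenchel-Young inequality at x, with an interior margin k. *)
Lemma strict_lower_conj_at E L x r k : into_infty E -> E x = r%:E ->
  interior K k -> strict_lower (conjugate K E L) (L x - r - k).
Proof.
move=> Einf Ex Kk; apply/strict_lower_conjP => //; exists x, r; split=> //.
by rewrite opprB addrC subrK.
Qed.

Lemma strict_lower_conj_neq0 E L : proper_map E ->
  strict_lower (conjugate K E L) !=set0.
Proof.
have [e Ke] := K_int.
move=> [Einf [x]]; rewrite /dom/=; case Ex : (E x) => [r||] // _.
  by exists (L x - r - e); exact: strict_lower_conj_at Ke.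
by move: (Einf x); rewrite Ex.
Qed.

Lemma epi_conjP E L y : proper_map E ->
  epi_conj K E (L, y) <-> clin L /\ ~ strict_lower (conjugate K E L) y.
Proof.
move=> Epr; have [e Ke] := K_int; rewrite /epi_conj /=; split=> -[cL].
  case=> -[v||] Ev [_ [k Kk <-]] //= [vky]; split=> // Ey.
  move/WSup_fin : Ev => [nEv _]; apply: nEv; rewrite -strict_lower_WSup.
  by apply: (lower_open_downward (@strict_lower_open _) Kk); rewrite vky.
move=> nEy; split=> //.
have [t t0] := upper_boundary_ray (@strict_lower_open _) Ke
  (strict_lower_conj_neq0 L Epr) nEy.
rewrite strict_lower_WSup => /WSup_fin Et.
exists (y - t *: e)%:E => //; exists (t *: e)%:E; last first.
  by congr EFin; exact: subrK.
by exists (t *: e) => //; exact: cone_ray.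
Qed.

(** This produces the enlarged members of the extended epigraph. If the conjugate at L were {+oo},
    lo N would be all of Y, so L is in the domain. *)
Lemma Epi_conj_WSup E L N : clin L ->
  strict_lower (conjugate K E L) !=set0 ->
  strict_lower (conjugate K E L) `<=` strict_lower N ->
  strict_lower N <> setT -> Epi_conj K E (L, WSup K N).
Proof.
move=> cL [y Ey] EN NT; split=> /=.
- by apply: WSup_P_p => //; exists y; exact: EN.
- split=> // ET; apply: NT; apply/seteqP; split=> // z _; apply: EN.
  by rewrite ET; exists +oo%E.
- move=> u [v||] Eu.
  + by move=> /WSup_fin[nNv _] vu; apply: nNv; apply: EN; exists u.
  + by case: u {Eu} => [u||] _ [].
  + by move=> /WSup_ninfty N0; have := EN _ Ey; rewrite N0.
Qed.

(** Members of extended epigraphs have larger lower sets than the conjugates, so a y outside their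
    sum is outside the sum for the conjugates. Conversely, y descends to a boundary point y - k, and
    enlarging only the first conjugate by k moves the boundary back to y. *)
Lemma Psi_boxplusP E1 E2 V L y : proper_map E1 -> proper_map E2 ->
  strict_lower V !=set0 ->
  Psi (boxplus K (boxplus K (Epi_conj K E1) (Epi_conj K E2)) [set (0, V)])
    (L, y) <->
  clin L /\ exists2 L', clin L' &
    ~ minkowski (minkowski (strict_lower (conjugate K E1 L'))
        (strict_lower (conjugate K E2 (L - L')))) (strict_lower V) y.
Proof.
move=> E1pr E2pr V0; have [e Ke] := K_int; split.
  case=> U [_ [[L1 U1] [[U1' PU1 /= ->] [cL1 _] EU1] [[L2 U2]
    [[U2' PU2 /= ->] [cL2 _] EU2] <-]] [_ ->] /= [<- <-]] /WSup_fin[nU _].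
  have -> : L1 + L2 + 0 = L1 + L2 by rewrite addr0.
  split; first exact: clinD.
  exists L1 => //; rewrite [L1 + L2]addrC addrK => E12; apply: nU.
  rewrite strict_lower_sum_ext strict_lower_uplus.
  apply: minkowski_sub E12 => //.
  by apply: minkowski_sub; exact: preceqK_strict_lower.
move=> [cL [L' cL' nDy]].
have cLL' : clin (L - L') by apply: clinD => //; exact: clinN.
pose S1 := strict_lower (conjugate K E1 L').
pose S2 := strict_lower (conjugate K E2 (L - L')).
have S10 : S1 !=set0 by exact: strict_lower_conj_neq0.
have S20 : S2 !=set0 by exact: strict_lower_conj_neq0.
pose D := minkowski (minkowski S1 S2) (strict_lower V).
have Do : lower_open D.
  by rewrite /D /S1 /S2 -!strict_lower_uplus; exact: strict_lower_open.
have D0 : D !=set0 by do !apply: minkowski_neq0.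
have [t t0 bD] := upper_boundary_ray Do Ke D0 nDy.
(* N is the first conjugate raised by k; [DE] moves this shift to the whole sum. *)
pose k := t *: e; pose N := sum_ext (conjugate K E1 L') [set k%:E].
have Kk : K k.
  exact: cone_ray.
have NE : strict_lower N = minkowski S1 (strict_lower [set k%:E]).
  by rewrite strict_lower_sum_ext.
have DE : minkowski D (strict_lower [set k%:E]) =
    minkowski (minkowski (strict_lower N) S2) (strict_lower V).
  rewrite NE /D -!minkowskiA; congr minkowski.
  by rewrite [RHS]minkowskiC -minkowskiA.
have bDk : upper_boundary (minkowski D (strict_lower [set k%:E])) y.
  exact: translate_upper_boundary.
have S1N : S1 `<=` strict_lower N.
  move=> z /(@strict_lower_open (conjugate K E1 L'))[h Kh S1z]; rewrite NE.
  exists (z + h) => //; exists (- h); last by rewrite addrK.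
  exists k%:E => //; apply/ltK_fin; rewrite opprK.
  exact: interior_coneD.
exists (uplus K (uplus K (WSup K N) (conjugate K E2 (L - L'))) V); last first.
  apply/WSup_fin; rewrite strict_lower_sum_ext strict_lower_uplus.
  by rewrite strict_lower_WSup -/S2 -DE.
(* A summand equal to Y would make the whole sum Y, but y lies outside it. So both weak suprema are
   in [P_p]. *)
have nT : strict_lower N <> setT /\ S2 <> setT.
  split=> ST; apply: (proj1 bDk); rewrite DE ST.
    rewrite [minkowski setT _]minkowskiC minkowskiT//.
    by rewrite minkowskiC minkowskiT.
  rewrite minkowskiT; last first.
    rewrite NE; apply: minkowski_neq0 => //; exists (k - e).
    by exists k%:E => //; apply/ltK_fin; rewrite opprB addrC subrK.
  by rewrite minkowskiC minkowskiT.
exists (L, uplus K (WSup K N) (conjugate K E2 (L - L'))); last first.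
  by exists (0, V) => //=; congr pair; rewrite addr0.
exists (L', WSup K N).
  by apply: Epi_conj_WSup => //; exact: (proj1 nT).
exists (L - L', conjugate K E2 (L - L')); last by rewrite /= subrKC.
apply: Epi_conj_WSup => //; first by rewrite strict_lower_WSup.
by have := proj2 nT; rewrite /S2 strict_lower_WSup.
Qed.

End conjugate_theory.

(** * Attainment for a family of dual sets *)

Section strong_duality.
Variables (J : Type) (I : set J) (V : J -> set (\bar Y)) (N : set (\bar Y)).
Hypothesis N_neq0 : strict_lower N !=set0.
Hypothesis weak_duality :
  forall j, I j -> strict_lower N `<=` strict_lower (V j).

(** A boundary point of lo N is outside some lo (V j), hence on its boundary by weak duality, so its
    opposite is a dual value. No dual value exceeds it, since anything strictly below the point is
    in lo N and so in every lo (V i). *)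
Lemma strong_duality_WMax : I !=set0 ->
  (forall y, ~ strict_lower N y -> exists2 j, I j & ~ strict_lower (V j) y) ->
  oppe @` WSup K N = WMax K (\bigcup_(j in I) oppe @` WSup K (V j)).
Proof.
move=> [j0 Ij0] strong; have [e Ke] := K_int.
have VN v : upper_boundary (strict_lower N) v ->
    exists2 j, I j & WSup K (V j) v%:E.
  move=> [nNv bv]; have [j Ij nVv] := strong _ nNv; exists j => //.
  by apply/WSup_fin; split=> // k /bv; exact: weak_duality.
have Vninfty j : I j -> ~ WSup K (V j) -oo%E.
  move=> Ij /WSup_ninfty V0; have [y /(weak_duality Ij)] := N_neq0.
  by rewrite V0.
(* If lo N is all of Y, weak duality makes every dual set {-oo}; an index j0 makes the union {-oo}
   rather than empty. *)
have [NT|NT] := pselect (strict_lower N = setT).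
  have VT j : I j -> strict_lower (V j) = setT.
    by move=> Ij; apply/seteqP; split=> // y _;
       apply: weak_duality => //; rewrite NT.
  have oppT M : strict_lower M = setT -> oppe @` WSup K M = [set -oo%E].
    move=> MT; apply/seteqP; split=> [_ [[v||] + <-]|_ ->] //=.
    - by move=> /WSup_fin[nMv]; case: nMv; rewrite MT.
    - by move=> /WSup_ninfty; rewrite MT => /seteqP[/(_ 0)/(_ Logic.I)].
    - by exists +oo%E => //; exact/WSup_pinfty.
  rewrite oppT// (_ : \bigcup_(j in I) _ = [set -oo%E]); last first.
    apply/seteqP; split=> [x [j Ij]|_ ->]; first by rewrite oppT// VT.
    by exists j0 => //; rewrite oppT// VT.
  apply/seteqP; split=> [_ ->|x []//]; split=> //.
  by apply/WSup_ninfty; apply/seteqP; split=> // y [_ ->].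
apply/seteqP; split=> [_ [[v||] + <-] /=|[x||] []].
- move=> /WSup_fin bv; have [j Ij Vv] := VN _ bv.
  have Vjv : (oppe @` WSup K (V j)) (- v)%:E by exists v%:E.
  split; first by exists j.
  apply/WSup_fin; split.
    case=> _ [i Ii [[u||] Vu <-]]; [|by case|by case: (Vninfty _ Ii)].
    change (~ ltK K (- v)%:E (- u)%:E) => /ltK_fin.
    rewrite opprK addrC => Kvu; move: Vu => /WSup_fin[nVu _].
    apply/nVu/weak_duality => //.
    by rewrite -(subKr v u); exact: (proj2 bv).
  move=> k Kk; exists (- v)%:E; first by exists j.
  by apply/ltK_fin; rewrite opprB addrC subrK.
- by move=> /WSup_pinfty /NT.
- by move=> /WSup_ninfty N0; case: N_neq0 => y; rewrite N0.
- move=> [j Ij [[v||] Vv // [vx]]] /WSup_fin[nDx _].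
  exists (- x)%:E; last by rewrite /= opprK.
  apply/WSup_fin; rewrite -vx opprK; move: Vv => /WSup_fin[nVv _].
  (* Were v - k outside lo N, it would be outside some lo (V i), and descending to that boundary
     would give a dual value strictly above x, against maximality. *)
  split=> [/(weak_duality Ij)//|k Kk]; apply: contrapT => /strong[i Ii nVi].
  have [t t0 bt] := upper_boundary_ray (@strict_lower_open _) Ke
    (subset_nonempty (weak_duality Ii) N_neq0) nVi.
  apply: nDx; exists (- (v - k - t *: e))%:E.
    exists i => //; exists (v - k - t *: e)%:E => //; exact/WSup_fin.
  apply/ltK_fin; rewrite -vx opprK !opprB -addrA subrK.
  have Kte : K (t *: e) by exact: cone_ray.
  exact: interior_coneD.
- by move=> [j Ij [[v||] // /(Vninfty _ Ij)]].
(* A maximal value -oo would leave no dual value above -oo, yet N has a boundary point and it yields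
   a finite one. *)
- move=> _ /WSup_ninfty D0; have [y Ny] := N_neq0.
  have [v /VN[j Ij Vv] _] := upper_boundary_above (@strict_lower_open _) Ny NT.
  suff : strict_lower (\bigcup_(j in I) oppe @` WSup K (V j)) (- v - e).
    by rewrite D0.
  exists (- v)%:E; first by exists j => //; exists v%:E.
  by apply/ltK_fin; rewrite opprB addrC subrK.
Qed.

(** Descend from y to the boundary of lo N. The opposite of the point reached is a dual value for
    some j, so the point is outside lo (V j), and y above it is too. *)
Lemma WMax_strong_duality :
  oppe @` WSup K N = WMax K (\bigcup_(j in I) oppe @` WSup K (V j)) ->
  forall y, ~ strict_lower N y -> exists2 j, I j & ~ strict_lower (V j) y.
Proof.
move=> NV y nNy; have [e Ke] := K_int.
have [t t0 /WSup_fin bt] :=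
  upper_boundary_ray (@strict_lower_open _) Ke N_neq0 nNy.
have : (oppe @` WSup K N) (- (y - t *: e))%:E by exists (y - t *: e)%:E.
rewrite NV => -[[j Ij [[v||] Vv // [/oppr_inj vy]]] _].
exists j => //; move: Vv => /WSup_fin[+ _]; apply: contra_not; rewrite vy => Vy.
apply: (lower_open_downward (k := t *: e) (@strict_lower_open _)).
  exact: (cone_ray Ke).
by rewrite subrK.
Qed.

End strong_duality.

(** * The epigraph identity and duality for abstract multipliers *)

Lemma uplusA M N Q : uplus K M (uplus K N Q) = uplus K (uplus K M N) Q.
Proof.
by apply: eq_WSup; rewrite !strict_lower_sum_ext !strict_lower_uplus minkowskiA.
Qed.

(** Through [epi_conjP] and [Psi_boxplusP], the identity at L says that each y outside the primal
    lower set is outside some dual one. The dual index pairs L' with a multiplier b. *)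
Lemma epigraph_strong_duality (X : tvsType R) (B : Type) (A : set B)
    (E E1 : X -> \bar Y) (E2 : B -> X -> \bar Y) (V : B -> set (\bar Y)) :
  proper_map E -> proper_map E1 -> (forall b, A b -> proper_map (E2 b)) ->
  (forall b, A b -> strict_lower (V b) !=set0) ->
  (forall b L L', A b -> strict_lower (conjugate K E L) `<=`
     minkowski (minkowski (strict_lower (conjugate K E1 L'))
       (strict_lower (conjugate K (E2 b) (L - L')))) (strict_lower (V b))) ->
  A !=set0 \/ epi_conj K E !=set0 ->
  epi_conj K E = \bigcup_(b in A)
    Psi (boxplus K (boxplus K (Epi_conj K E1) (Epi_conj K (E2 b)))
      [set (0, V b)])
  <-> forall L, clin L -> oppe @` conjugate K E L =
        WMax K (\bigcup_(j in clin `*` A) oppe @`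
          (uplus K (uplus K (conjugate K E1 j.1)
             (conjugate K (E2 j.2) (L - j.1))) (V j.2))).
Proof.
move=> Epr E1pr E2pr V0 weak A0_or_epi.
pose N (L : X -> Y) := range (fun x => ((L x)%:E - E x)%E).
pose D L (j : (X -> Y) * B) := sum_ext (uplus K (conjugate K E1 j.1)
  (conjugate K (E2 j.2) (L - j.1))) (V j.2).
have NE L : strict_lower (N L) = strict_lower (conjugate K E L).
  by rewrite strict_lower_WSup.
have N0 L : strict_lower (N L) !=set0.
  by rewrite NE; exact: strict_lower_conj_neq0.
have DE L j : strict_lower (D L j) = minkowski (minkowski
    (strict_lower (conjugate K E1 j.1))
    (strict_lower (conjugate K (E2 j.2) (L - j.1)))) (strict_lower (V j.2)).
  by rewrite strict_lower_sum_ext strict_lower_uplus.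
have wd L j : (clin `*` A) j -> strict_lower (N L) `<=` strict_lower (D L j).
  by case=> _ Aj; rewrite NE DE; exact: weak.
split=> [epiE L cL|dualE].
  (* A point of the epigraph lies in the union and so exhibits a multiplier. *)
  have A0 : A !=set0.
    case: A0_or_epi => // -[p]; rewrite epiE => -[b Ab _]; by exists b.
  apply: (strong_duality_WMax (N0 L) (wd L)).
    by have [b Ab] := A0; exists (0, b); split=> //; exact: clin0.
  move=> y; rewrite NE => nEy.
  have : epi_conj K E (L, y) by apply/epi_conjP.
  rewrite epiE => -[b Ab] /(Psi_boxplusP L y E1pr (E2pr _ Ab) (V0 _ Ab)).
  by move=> [_ [L' cL' nDy]]; exists (L', b) => //; rewrite DE.
apply/seteqP; split=> -[L y].
  move=> /(epi_conjP _ _ Epr)[cL]; rewrite -NE.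
  move=> /(WMax_strong_duality (V := D L) (N0 L) (dualE L cL)).
  move=> [[L' b] [/= cL' Ab]].
  rewrite DE => nDy; exists b => //.
  by apply/(Psi_boxplusP L y E1pr (E2pr _ Ab) (V0 _ Ab)); split=> //; exists L'.
move=> [b Ab] /(Psi_boxplusP L y E1pr (E2pr _ Ab) (V0 _ Ab))[cL [L' cL' nDy]].
by apply/epi_conjP => //; split=> // /(weak b L L' Ab).
Qed.

(** For lower-open A this is membership in the closure of A. It lets inequalities be added by
    splitting the margin k. *)
Definition weakly_below (A : set Y) (a : Y) : Prop :=
  forall k, interior K k -> A (a - k).

Lemma weakly_below_minkowski A B a b :
  weakly_below A a -> weakly_below B b -> weakly_below (minkowski A B) (a + b).
Proof.
move=> Aa Bb _ /interior_cone_half[h Kh ->].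
exists (a - h); first exact: Aa.
by exists (b - h); [exact: Bb|rewrite addrACA opprD].
Qed.

End ordering_cone.

(** * The composite problem and its weak duality *)

Section composite_problem.
Context {R : realType} {X Y Z W : tvsType R}.
Variables (K : set Y) (S : set Z).
Variables (F : X -> \bar Y) (kappa : W -> \bar Y).
Variables (H : X -> \bar W) (G : X -> \bar Z) (C : set X).
Hypotheses (K_cone : convex_cone K) (K_closed : closed K).
Hypotheses (K_int : interior K !=set0) (S_nonempty : S !=set0).
Hypotheses (F_proper : proper_map F) (kappa_proper : proper_map kappa).
Hypothesis feas :
  feasible S G C `&` dom F `&` H @^-1` (EFin @` dom kappa) !=set0.

Let E := constrained_objective S F kappa H G C.

Lemma comp_infty_neq (U : Type) (f : W -> \bar U) x :
  into_infty f -> comp_infty f H x <> -oo%E.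
Proof. by rewrite /comp_infty => f_inf; case: (H x). Qed.

Lemma constrained_objectiveP x r : E x = r%:E <->
  feasible S G C x /\ exists f w k,
    [/\ F x = f%:E, H x = w%:E, kappa w = k%:E & r = f + k].
Proof.
rewrite /E /constrained_objective /objective /indic_map /comp_infty; split.
  have := proj1 F_proper x; case: asboolP => Ax; case Hx : (H x) => [w||];
    case Fx : (F x) => [f||] //=;
    (have := proj1 kappa_proper w; case kw : (kappa w) => [k||] //=) || idtac.
  by move=> _ _ [<-]; split=> //; exists f, w, k; rewrite addr0.
move=> [Ax [f [w [k [Fx Hx kw ->]]]]].
by rewrite asboolT// Hx kw Fx /= addr0.
Qed.

Lemma constrained_objective_proper : proper_map E.
Proof.
have [x [[Ax Fx] [w kw Hx]]] := feas.
have [f Ef] : exists f, F x = f%:E.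
  by move: (proj1 F_proper x) Fx; rewrite /dom/=; case: (F x) => // f; exists f.
have [k Ek] : exists k, kappa w = k%:E.
  by move: (proj1 kappa_proper w) kw; rewrite /dom/=;
     case: (kappa w) => // k; exists k.
split=> [y Ey|].
  have := proj1 F_proper y;
    have := @comp_infty_neq _ kappa y (proj1 kappa_proper).
  move: Ey; rewrite /E /constrained_objective /objective /indic_map.
  by case: asboolP => _; case: (comp_infty kappa H y) => [?||];
     case: (F y) => [?||].
exists x; rewrite /dom /=; suff -> : E x = (f + k)%:E by [].
by apply/constrained_objectiveP; split=> //; exists f, w, k.
Qed.

Lemma scalarizedP (T1 : W -> Y) (T2 : Z -> Y) x r :
  scalarized H G C T1 T2 x = r%:E <->
  C x /\ exists w z, [/\ H x = w%:E, G x = z%:E & r = T1 w + T2 z].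
Proof.
rewrite /scalarized /indic_map /comp_infty; split.
  case: asboolP => Cx; case Hx : (H x) => [w||]; case Gx : (G x) => [z||] //=.
  by move=> [<-]; split=> //; exists w, z; rewrite addr0.
move=> [Cx [w [z [Hx Gx ->]]]].
by rewrite asboolT// Hx Gx /= addr0.
Qed.

Lemma scalarized_proper (T1 : W -> Y) (T2 : Z -> Y) :
  proper_map (scalarized H G C T1 T2).
Proof.
split=> [x|].
  rewrite /scalarized /indic_map /comp_infty.
  by case: asboolP => _; case: (H x) => [?||]; case: (G x) => [?||].
have [x [[[Cx [z Sz Gx]] _] [w kw Hx]]] := feas.
exists x; rewrite /dom /=.
suff -> : scalarized H G C T1 T2 x = (T1 w + T2 z)%:E by [].
by apply/scalarizedP; split=> //; exists w, z.
Qed.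

Lemma indic_opp_set_proper :
  proper_map (indic_map (opp_set S) : Z -> \bar Y).
Proof.
split=> [z|]; rewrite /indic_map; first by case: asboolP.
have [s Ss] := S_nonempty; exists (- s); rewrite /dom /= asboolT//.
by exists s.
Qed.

(** Infeasible points contribute only -oo to the range defining the conjugate, so both sides have
    the same lower set. *)
Lemma WInf_constrained L :
  WInf K [set (objective F kappa H x - (L x)%:E)%E | x in feasible S G C] =
  oppe @` conjugate K E L.
Proof.
congr image; apply: eq_WSup => //; apply/seteqP; split=> y.
  case=> _ [_ [x Ax <-] <-] yx; exists ((L x)%:E - E x)%E; first by exists x.
  move: yx; rewrite /E /constrained_objective /indic_map asboolT//.
  by case: (objective F kappa H x) => [r||] //=; rewrite addr0 opprB.
case=> _ [x _ <-]; case Ex : (E x) => [r||] // yx.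
  move/constrained_objectiveP: Ex => [Ax [f [w [k [Fx Hx kw rE]]]]].
  exists (oppe (objective F kappa H x - (L x)%:E)).
    by eexists; [exists x|].
  suff -> : oppe (objective F kappa H x - (L x)%:E) = (L x - r)%:E by [].
  by rewrite rE /objective Fx /comp_infty Hx kw /= opprB.
by have := proj1 constrained_objective_proper x; rewrite Ex.
Qed.


Section multipliers.
Variables (A : set ((W -> Y) * (Z -> Y))).
Variable V : (W -> Y) * (Z -> Y) -> set (\bar Y).
Hypothesis V_neq0 : forall b, A b -> strict_lower K (V b) !=set0.
(** The two duals differ in how they meet this: by the Fenchel-Young inequality for the indicator of
    -S, or by T2 mapping -S into -K. *)
Hypothesis V_below : forall b z c, A b -> opp_set S z ->
  weakly_below K (strict_lower K (conjugate K kappa b.1)) c ->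
  weakly_below K (strict_lower K (V b)) (c + b.2 z).

(* At a feasible point x, the Fenchel-Young inequalities for F, for the
   scalarization and for kappa, together with V_below at z = G x, add up to a
   lower bound for L x minus the objective. *)
Lemma weak_duality_composite b L L' : A b ->
  strict_lower K (conjugate K E L) `<=`
  minkowski (minkowski (strict_lower K (conjugate K F L'))
    (strict_lower K (conjugate K (scalarized H G C b.1 b.2) (L - L'))))
    (strict_lower K (V b)).
Proof.
case: b => T1 T2 Ab y /(strict_lower_conjP K_cone K_closed K_int).
move=> /(_ (proj1 constrained_objective_proper)) [x [r []]].
move=> /constrained_objectiveP[[Cx [z Sz Gx]]].
move=> [f [w [k [Fx Hx kw ->]]]] Kq /=.
have qE : (L' x - f) + ((L x - L' x) - (T1 w + T2 z)) + (T1 w - k + T2 z) =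
    L x - (f + k).
  have -> : L' x - f + (L x - L' x - (T1 w + T2 z)) =
      L x - f - (T1 w + T2 z).
    by rewrite addrA; congr (_ - _); rewrite addrC addrA subrK.
  have cancel : - (T1 w + T2 z) + (T1 w - k + T2 z) = - k.
    by rewrite addrA [T1 w + _]addrC opprD addrA subrK addrAC addNr add0r.
  by rewrite -[LHS]addrA cancel opprD addrA.
(* Here y is L x - (f + k) minus an interior vector, so it suffices that the three terms of [qE] are
   weakly below the three lower sets. *)
rewrite -(subKr (L x - (f + k)) y) -qE.
apply: (weakly_below_minkowski K_cone) => //; last by rewrite qE.
  apply: (weakly_below_minkowski K_cone) => // h Kh.
    by apply: strict_lower_conj_at => //; exact: (proj1 F_proper).
  have Ex : scalarized H G C T1 T2 x = (T1 w + T2 z)%:E.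
    by apply/scalarizedP; split=> //; exists w, z.
  have scal_inf := proj1 (scalarized_proper T1 T2).
  exact: (strict_lower_conj_at K_cone K_closed K_int (L - L') scal_inf Ex Kh).
apply: (V_below (b := (T1, T2))) => // h Kh.
by apply: strict_lower_conj_at => //; exact: (proj1 kappa_proper).
Qed.

Lemma composite_strong_duality : A !=set0 \/ epi_conj K E !=set0 ->
  epi_conj K E = \bigcup_(b in A) Psi (boxplus K
    (boxplus K (Epi_conj K F) (Epi_conj K (scalarized H G C b.1 b.2)))
    [set (0, V b)])
  <-> stable_strong_duality K S F kappa H G C (fun L =>
        \bigcup_(j in clin `*` A) oppe @` uplus K (uplus K (conjugate K F j.1)
          (conjugate K (scalarized H G C j.2.1 j.2.2) (L - j.1))) (V j.2)).
Proof.
move=> /(epigraph_strong_duality K_cone K_closed K_int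
  constrained_objective_proper F_proper
  (fun b _ => scalarized_proper b.1 b.2) V_neq0 weak_duality_composite) ->.
by split=> dual L cL; have := dual L cL; rewrite WInf_constrained.
Qed.

End multipliers.

End composite_problem.

(** * Zero multipliers and the two equivalences *)

Lemma clin0_L_plus {R : realType} {U V : tvsType R} (S : set U) (K : set V) :
  K 0 -> L_plus S K 0.
Proof. by move=> K0; split; [exact: clin0|move=> _ [s _ <-]]. Qed.

Lemma clin0_L_plus_w {R : realType} {U V : tvsType R} (S : set U) (K : set V) :
  ~ interior K 0 -> L_plus_w S K 0.
Proof.
move=> K0; split; first exact: clin0.
apply/seteqP; split=> // _ [[s _ <-] [k Kk k0]].
have kE : - k = - 0 by rewrite k0 oppr0.
by apply: K0; rewrite -(oppr_inj kE).
Qed.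

(* Each equivalence carries the weakest side condition under which it is true.
   If there is no multiplier T1 and epi (F + kappa o H + I_A)^* is empty, both
   sides of the epigraph identity are empty, hence equal, while the union of
   the dual sets is empty, so that its WMax is empty, whereas WInf of a set is
   never empty. *)
Theorem corollary5p4 (R : realType) (X Y Z W : tvsType R)
    (hausX : hausdorff_space X) (hausY : hausdorff_space Y)
    (hausZ : hausdorff_space Z) (hausW : hausdorff_space W)
    (K : set Y) (P : set W) (S : set Z)
    (K_cone : convex_cone K) (K_closed : closed K)
    (K_int : interior K !=set0) (K_proper : K <> setT)
    (P_cone : convex_cone P) (P_nonempty : P !=set0)
    (S_cone : convex_cone S) (S_nonempty : S !=set0)
    (F : X -> \bar Y) (kappa : W -> \bar Y)
    (H : X -> \bar W) (G : X -> \bar Z)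
    (F_proper : proper_map F) (kappa_proper : proper_map kappa)
    (H_proper : proper_map H) (G_proper : proper_map G)
    (C : set X) (C_nonempty : C !=set0)
    (feas : feasible S G C `&` dom F `&` H @^-1` (EFin @` dom kappa)
            !=set0) :
  ((dom_conj K kappa !=set0 \/
    epi_conj K (constrained_objective S F kappa H G C) !=set0) ->
   (epi_conj K (constrained_objective S F kappa H G C)
      = M2 K S F kappa H G C
    <-> stable_strong_duality K S F kappa H G C
          (dual_union K S F kappa H G C)))
  /\
  ((dom_conj K kappa `&` L_plus P K !=set0 \/
    epi_conj K (constrained_objective S F kappa H G C) !=set0) ->
   (epi_conj K (constrained_objective S F kappa H G C)
      = M2_plus K P S F kappa H G C
    <-> stable_strong_duality K S F kappa H G C
          (dual_union_plus K P S F kappa H G C))).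

Proof.
have conj_neq0 (U : tvsType R) (f : U -> \bar Y) (L : U -> Y) :
    proper_map f -> strict_lower K (conjugate K f L) !=set0.
  exact: strict_lower_conj_neq0.
split=> nonempty.
- pose A := dom_conj K kappa `*` L_plus_w S K.
  pose V b := uplus K (conjugate K kappa b.1) (conj_ind K S b.2).
  have -> : M2 K S F kappa H G C = \bigcup_(b in A) Psi (boxplus K
      (boxplus K (Epi_conj K F) (Epi_conj K (scalarized H G C b.1 b.2)))
      [set (0, V b)]).
    apply/seteqP; split=> p.
      by case=> T1 T1_dom [T2 T2_pos pM]; exists (T1, T2).
    by case=> -[T1 T2] [T1_dom T2_pos] pM; exists T1 => //; exists T2.
  have -> : dual_union K S F kappa H G C = fun L =>
      \bigcup_(j in clin `*` A) oppe @` uplus K (uplus K (conjugate K F j.1)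
        (conjugate K (scalarized H G C j.2.1 j.2.2) (L - j.1))) (V j.2).
    apply/funext => L; apply/seteqP; split=> y.
      case=> L' cL' [T1 T1_dom [T2 T2_pos yD]]; exists (L', (T1, T2)) => //.
      by rewrite /V uplusA.
    case=> -[L' [T1 T2]] [cL' [T1_dom T2_pos]]; rewrite /V uplusA// => yD.
    by exists L' => //; exists T1 => //; exists T2.
  have indic_pr := indic_opp_set_proper (Y := Y) S_nonempty.
  have VE b : strict_lower K (V b) = minkowski
      (strict_lower K (conjugate K kappa b.1))
      (strict_lower K (conj_ind K S b.2)).
    exact: strict_lower_uplus.
  apply: composite_strong_duality => //.
  + by move=> b _; rewrite VE; apply: minkowski_neq0; exact: conj_neq0.
  + move=> b z c _ Sz kc; rewrite VE.
    apply: (weakly_below_minkowski K_cone) => // h Kh.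
    (* The subtracted 0 is the value of the indicator at z in -S. *)
    rewrite -[b.2 z]subr0.
    apply: strict_lower_conj_at => //; first exact: (proj1 indic_pr).
    by rewrite /indic_map asboolT.
  + case: nonempty => [[T1 T1_dom]|]; [left|by right].
    exists (T1, 0); split=> //; apply: clin0_L_plus_w.
    exact: interior_cone_neq0.
- pose A := (dom_conj K kappa `&` L_plus P K) `*` L_plus S K.
  pose V (b : (W -> Y) * (Z -> Y)) := conjugate K kappa b.1.
  have -> : M2_plus K P S F kappa H G C = \bigcup_(b in A) Psi (boxplus K
      (boxplus K (Epi_conj K F) (Epi_conj K (scalarized H G C b.1 b.2)))
      [set (0, V b)]).
    apply/seteqP; split=> p.
      by case=> T1 T1_dom [T2 T2_pos pM]; exists (T1, T2).
    by case=> -[T1 T2] [T1_dom T2_pos] pM; exists T1 => //; exists T2.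
  have -> : dual_union_plus K P S F kappa H G C = fun L =>
      \bigcup_(j in clin `*` A) oppe @` uplus K (uplus K (conjugate K F j.1)
        (conjugate K (scalarized H G C j.2.1 j.2.2) (L - j.1))) (V j.2).
    apply/funext => L; apply/seteqP; split=> y.
      by case=> L' cL' [T1 T1_dom [T2 T2_pos yD]]; exists (L', (T1, T2)).
    case=> -[L' [T1 T2]] [cL' [T1_dom T2_pos]] yD.
    by exists L' => //; exists T1 => //; exists T2.
  apply: composite_strong_duality => //.
  + by move=> b _; exact: conj_neq0.
  (* As T2 (- s) = - T2 s with T2 s in K, the margin h only grows to the interior vector T2 s +
     h. *)
  + move=> [T1 T2] _ c [_ [[lT2 _] T2_pos]] [s Ss <-] kc h Kh.
    have -> : c + T2 (- s) - h = c - (T2 s + h).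
      have -> : T2 (- s) = - T2 s.
        exact: (linearN (HB.pack T2
          (GRing.isLinear.Build R Z Y *:%R T2 lT2) : {linear Z -> Y})).
      by rewrite opprD addrA.
    apply: kc; apply: interior_coneD => //.
    by apply: T2_pos; exists s.
  + case: nonempty => [[T1 T1_dom]|]; [left|by right].
    exists (T1, 0); split=> //; apply: clin0_L_plus.
    exact: cone0.
Qed.
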